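(* Let $k\ge 1$ and let $\mathcal{M}=\{q_1,\dots,q_k\}$ be a finite set of prime numbers (the prime $2$ is allowed). Then there exists $n_{\mathcal{M}}\in\mathbb{N}$ such that for every integer $N\ge n_{\mathcal{M}}$ there exists a sequence of $N$ consecutive integers $a,a+1,\dots,a+N-1$ such that none of them is relatively prime to the product of all the others. Moreover, for each member $x$ of the sequence, the greatest common divisor of $x$ and the product of all the other members is divisible by some prime $p$ with $p\notin\mathcal{M}$. *)

(* Defs.v *)
From HB Require Import structures.
From mathcomp Require Import all_boot all_order all_algebra.
Set Implicit Arguments. Unset Strict Implicit. Unset Printing Implicit Defensive.
Import Order.TTheory GRing.Theory Num.Theory.

(* Main.v *)
Require Import Defs.
From HB Require Import structures.
From mathcomp Require Import all_boot all_order all_algebra.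
From mathcomp Require Import zify.
Import Order.TTheory GRing.Theory Num.Theory.

(** By the Chinese remainder theorem it suffices to choose, for finitely many
    primes [p] outside [M], a residue class mod [p] so that every position in
    [0, N) lies in a chosen class containing at least two positions.  Let [F] be
    the primes in (N/16, N/2], let [Q] be a fixed set of primes outside [M] with
    [17 * prod (p - 1) <= prod p], and let [w] bound [M] and [Q].  Primes outside
    [M], [Q] and [F] take the class of 0.  The positions they miss are [w]-smooth
    or of the form [s * p] with [p] in [F] and [s < 16]; since there are only
    polylogarithmically many smooth numbers, Chebyshev's estimates bound the
    number of missed positions by [17 * |F|].  Choosing the classes for [Q]
    greedily leaves at most [|F|] of them, and each prime of [F] takes one.  All
    classes of primes [p <= N/2] contain two positions, and for larger [p] the
    class of 0 contains 0 besides the position it is used for. *)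

(** * Polylogarithmic growth and smooth numbers *)

Lemma poly_le_exp c r : exists x0, forall x, x0 <= x -> c * x ^ r <= 2 ^ x.
Proof.
(* With this [d], the power [x ^ r] uses at most half of the exponent [x]; the other half absorbs
   the constant [c * d ^ r]. *)
pose d := 2 * r.+1.
exists (2 * (c * d ^ r)) => x Hx.
have d0 : 0 < d by [].
have Hm : x <= d * 2 ^ (x %/ d).
  have := ltn_ceil x d0; have := ltn_expl (x %/ d) (isT : 1 < 2).
  by nia.
have Hq : (x %/ d) * r + x %/ 2 <= x.
  have := leq_trunc_div x d; have := divn_eq x 2; rewrite /d; nia.
apply: leq_trans (leq_pexp2l (isT : 0 < 2) Hq).
rewrite expnD expnM.
apply: (@leq_trans (c * (d * 2 ^ (x %/ d)) ^ r)).
  rewrite leq_mul2l; apply/orP; right.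
  by case: (posnP r) => [->|r0]; rewrite ?expn0 // leq_exp2r.
rewrite expnMn mulnCA mulnA [_ * c]mulnC mulnC leq_mul2l.
apply/orP; right; apply: leq_trans (ltnW (ltn_expl _ _)) => //.
by rewrite leq_divRL // mulnC.
Qed.

Lemma log_poly_le c r : exists x0, forall x, x0 <= x -> c * (trunc_log 2 x).+1 ^ r <= x.
Proof.
have [t0 Ht] := poly_le_exp (2 * c) r.
exists (2 ^ t0) => x Hx.
have x0 : 0 < x by apply: leq_trans Hx; rewrite expn_gt0.
have := trunc_logP (isT : 1 < 2) x0; have /Ht := leqW (trunc_log_max (isT : 1 < 2) Hx).
by rewrite expnS -mulnA leq_mul2l /=; exact: leq_trans.
Qed.

Definition smooth k n := all (fun p => p <= k) (primes n).

(** A [k]-smooth number is determined by its exponents at the indices [p <= k], each at most log2 of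
    [x], so exponent vectors give an injection. As 0 passes [smooth] vacuously, the sum starts at
    1. *)
Lemma smooth_count k x :
  \sum_(1 <= n < x.+1) smooth k n <= (trunc_log 2 x).+1 ^ k.+1.
Proof.
set L := trunc_log 2 x.
pose A := [set i : 'I_x.+1 | (0 < i) && smooth k i].
have -> : \sum_(1 <= n < x.+1) smooth k n = #|A|.
  rewrite -sum1_card [RHS]big_mkcond.
  rewrite (eq_bigr (fun i : 'I_x.+1 => nat_of_bool ((0 < i) && smooth k i))); last first.
    by move=> i _; rewrite /A inE; case: (_ && _).
  rewrite -(big_mkord xpredT (fun i => nat_of_bool ((0 < i) && smooth k i))).
  by rewrite [RHS]big_ltn //= add0n; apply: eq_big_nat => i /andP[-> _].
pose f (i : 'I_x.+1) : {ffun 'I_k.+1 -> 'I_L.+1} := [ffun p : 'I_k.+1 => inord (logn p i)].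
have fP (i : 'I_x.+1) (p : 'I_k.+1) : 0 < i -> f i p = logn p i :> nat.
  move=> i0; rewrite ffunE inordK // ltnS.
  apply: trunc_log_max => //.
  apply: leq_trans (_ : i <= x); last by rewrite -ltnS.
  case: (boolP (prime p)) => [pp|/negPf np]; last by rewrite lognE np.
  apply: leq_trans (dvdn_leq i0 (pfactor_dvdnn p i)).
  by case: (posnP (logn p i)) => [->//|l0]; rewrite leq_exp2r // prime_gt1.
have f_inj : {in A &, injective f}.
  move=> i j; rewrite /A !inE => /andP[i0 /allP si] /andP[j0 /allP sj] eqf.
  apply/val_inj/eqn_from_log => // p.
  have [pk|kp] := ltnP p k.+1.
    by rewrite -(fP i (Ordinal pk) i0) -(fP j (Ordinal pk) j0) eqf.
  have out (n : nat) : {in primes n, forall q, q <= k} -> logn p n = 0.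
    move=> sn; apply/eqP; rewrite -leqn0 leqNgt logn_gt0.
    by apply: contraL kp => /sn; rewrite -ltnNge.
  by rewrite !out.
rewrite -(card_in_imset f_inj) (leq_trans (max_card _)) //.
by rewrite card_ffun !card_ord.
Qed.

(** * Greedy sieving and Chinese remaindering *)

Lemma pigeon_residue (U : seq nat) p : 0 < p ->
  exists c, size U <= p * count (fun u => u == c %[mod p]) U.
Proof.
move=> p0; pose g (c : 'I_p) := count (fun u => u == c %[mod p]) U.
have sumg : size U = \sum_(c < p) g c.
  rewrite /g; elim: U {g} => [|u U IH] /=; first by rewrite big1.
  rewrite big_split /= -IH (bigD1 (Ordinal (ltn_pmod u p0))) //= modn_mod eqxx.
  rewrite big1 ?add1n // => i; apply: contraNeq; rewrite -lt0n.
  by case: eqP => // eu _; apply/eqP/val_inj; rewrite /= eu modn_small.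
have [c _ cmax] := @arg_maxnP _ (Ordinal p0) xpredT g isT.
exists c; have <- : \sum_(i < p) g c = p * g c by rewrite sum_nat_const card_ord.
by rewrite sumg; apply: leq_sum => i _; apply: cmax.
Qed.

(** Each modulus in turn takes the residue class most populated among the current survivors, which
    keeps at most a proportion (p-1)/p of them. *)
Lemma greedy_sieve (Q U : seq nat) : uniq Q -> all (leq 1) Q ->
  exists r : nat -> nat,
    size [seq u <- U | all (fun p => u != r p %[mod p]) Q] * \prod_(p <- Q) p
      <= size U * \prod_(p <- Q) p.-1.
Proof.
elim: Q U => [|p Q IH] U /=.
  by exists id; rewrite filter_predT !big_nil.
case/andP=> pQ uQ /andP[p0 Q0].
have [c Hc] := pigeon_residue U p p0.
pose V := [seq u <- U | u != c %[mod p]].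
have [r Hr] := IH V uQ Q0.
exists (fun q => if q == p then c else r q).
rewrite !big_cons eqxx.
have -> : [seq u <- U | (u != c %[mod p]) &&
    all (fun q => u != (if q == p then c else r q) %[mod q]) Q] =
    [seq u <- V | all (fun q => u != r q %[mod q]) Q].
  rewrite /V -filter_predI; apply: eq_filter => u /=; rewrite andbC; congr (_ && _).
  by apply: eq_in_all => q qQ; case: (q =P p) => // qp; rewrite -qp qQ in pQ.
have HV : size V * p <= size U * p.-1.
  have cntC : count (fun u => u == c %[mod p]) U +
    count (fun u => u != c %[mod p]) U = size U by exact: count_predC.
  rewrite size_filter; move: (prednK p0) Hc (congr1 (muln p) cntC).
  set x := count _ _; set y := count _ U; move: p.-1 (size U) => p' n <-; nia.
rewrite mulnCA mulnA [size U * _]mulnA.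
move: HV Hr; set a := size _; set b := size V; set P := \prod_(_ <- _) _; set P' := \prod_(_ <- _) _.
nia.
Qed.

Lemma chinese_primes (s : seq nat) (c : nat -> nat) : uniq s -> all prime s ->
  exists a, forall p, p \in s -> a = c p %[mod p].
Proof.
elim: s => [|p s IH] /=; first by exists 0.
case/andP=> ps us /andP[pp pps]; have [a Ha] := IH us pps.
have cop : coprime p (\prod_(q <- s) q).
  rewrite big_seq; elim/big_ind: _ => [|x y|q qs]; first exact: coprimen1.
    by rewrite coprimeMr => -> ->.
  rewrite prime_coprime // dvdn_prime2 //; last exact: (allP pps).
  by apply: contraNneq ps => ->.
exists (chinese p (\prod_(q <- s) q) (c p) a) => q; rewrite inE => /predU1P[->|qs].
  exact: chinese_modl.
rewrite -Ha //; apply/eqP.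
have /eqP := chinese_modr cop (c p) a.
have /dvdnP[t ->] : q %| \prod_(q <- s) q by rewrite (big_rem q qs) dvdn_mulr.
move/eqP/(congr1 (modn^~ q)).
by rewrite !modn_dvdm ?dvdn_mull // => ->.
Qed.

(** * Divergence of the Euler product over primes *)

(** An integer form of 1 + sum 1/p <= prod p/(p-1), with floors in place of x/p. *)
Lemma prod_pred_le x (Q : seq nat) : all (leq 1) Q ->
  (x + \sum_(p <- Q) x %/ p) * \prod_(p <- Q) p.-1 <= x * \prod_(p <- Q) p.
Proof.
elim: Q => [|p Q IH] /=; first by rewrite !big_nil addn0.
case/andP=> p0 /IH {IH}; rewrite !big_cons.
have := leq_trunc_div x p; set d := x %/ p; have := prednK p0.
move: p.-1 (\sum_(_ <- _) _) (\prod_(_ <- _) _) (\prod_(_ <- _) _) => p' S P P' <- Hd H.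
apply: (@leq_trans (p'.+1 * ((x + S) * P'))); last by rewrite [leqRHS]mulnCA leq_mul2l H orbT.
rewrite !mulnA leq_mul2r; apply/orP; right; nia.
Qed.

(* Erdős: if the primes in (k, x] had small reciprocal sum, most integers up to
   x would be k-smooth, but there are only polylogarithmically many of those. *)
Lemma prime_block k : exists2 x, k <= x &
  3 * \prod_(p <- index_iota k.+1 x.+1 | prime p) p.-1
    <= 2 * \prod_(p <- index_iota k.+1 x.+1 | prime p) p.
Proof.
have [x0 Hx0] := log_poly_le 2 k.+1.
pose x := (maxn k x0).+1; exists x; first by rewrite leqW // leq_maxl.
have Hx : 2 * \sum_(1 <= n < x.+1) smooth k n <= x.
  apply: leq_trans (Hx0 x _); last by rewrite leqW // leq_maxr.
  by rewrite leq_mul2l smooth_count.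
pose Q := [seq p <- index_iota k.+1 x.+1 | prime p].
(* A non-smooth [n] is a multiple of some prime in [Q], and [x %/ p] counts the multiples of [p] up
   to [x]. *)
have cover : x <= \sum_(1 <= n < x.+1) smooth k n + \sum_(p <- Q) x %/ p.
  rewrite (eq_bigr _ (fun p _ => divn_count_dvd p x)) exchange_big -big_split /=.
  have {1}-> : x = \sum_(1 <= n < x.+1) 1 by rewrite sum_nat_const_nat muln1 subn1.
  rewrite big_nat [leqRHS]big_nat; apply: leq_sum => n /andP[n0 nx].
  case: (boolP (smooth k n)) => // /allPn[q qn]; rewrite -ltnNge => kq.
  have [qp qn' /=] : prime q /\ q %| n by move: qn; rewrite mem_primes => /and3P[].
  rewrite add0n (big_rem q) /= ?qn' //.
  by rewrite mem_filter qp mem_index_iota kq /= (leq_ltn_trans (dvdn_leq _ qn')).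
rewrite -!(big_filter _ prime) -/Q.
have Q1 : all (leq 1) Q.
  by apply/allP => p; rewrite mem_filter => /andP[/prime_gt0].
have := prod_pred_le x Q Q1.
(* At most half of the integers are smooth, so the floors sum to at least x/2; this is the source of
   the factor 3/2. *)
have : 3 * x <= 2 * (x + \sum_(p <- Q) x %/ p) by lia.
set P' := \prod_(_ <- _) _; set P := \prod_(_ <- _) _; set S := x + _ => H1 H2.
have x1 : 0 < x by [].
rewrite -(leq_pmul2l x1); nia.
Qed.

(** Concatenates [t] successive disjoint blocks from [prime_block], each contributing a factor
    3/2. *)
Lemma prime_euler_product t k : exists Q : seq nat,
  [/\ uniq Q, all prime Q, all (leq k.+1) Q
    & 3 ^ t * \prod_(p <- Q) p.-1 <= 2 ^ t * \prod_(p <- Q) p].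
Proof.
elim: t k => [|t IH] k; first by exists [::]; rewrite !big_nil.
have [x kx Hx] := prime_block k; have [Q [uQ pQ gQ HQ]] := IH x.
exists ([seq p <- index_iota k.+1 x.+1 | prime p] ++ Q); split.
- rewrite cat_uniq filter_uniq ?iota_uniq //= uQ andbT.
  apply/hasPn => p /(allP gQ) xp; rewrite mem_filter mem_index_iota.
  by rewrite [p < _]ltnNge xp !andbF.
- by rewrite all_cat pQ andbT filter_all.
- rewrite all_cat; apply/andP; split; apply/allP => p.
    by rewrite mem_filter mem_index_iota => /and3P[].
  by move/(allP gQ); apply: leq_trans.
- by rewrite !big_cat /= !big_filter !expnS mulnACA [leqRHS]mulnACA leq_mul.
Qed.

(** * Chebyshev's estimates via central binomial coefficients *)

Lemma central_bin_ge n : 2 ^ n <= 'C(2 * n, n).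
Proof.
elim: n => // n IH; rewrite expnS mulnS !addSn add0n binS.
have := binS (2 * n) n; have := leq_bin2l n (leqnSn (2 * n)); lia.
Qed.

(** By Legendre's formula the exponent is a sum of terms floor(2n/p^k) - 2 floor(n/p^k), each 0 or
    1, and 0 once p^k exceeds 2n. *)
Lemma logn_central_bin p n : prime p -> 0 < n -> p ^ logn p 'C(2 * n, n) <= 2 * n.
Proof.
move=> pp n0; have p1 := prime_gt1 pp.
set v := logn _ _; set L := trunc_log p (2 * n).
suff vL : v <= L.
  by apply: leq_trans (trunc_logP p1 _); rewrite ?leq_pexp2l ?muln_gt0 // ltnW.
have H : v + 2 * logn p n`! = logn p (2 * n)`!.
  rewrite -(@bin_fact (2 * n) n); last by lia.
  have -> : 2 * n - n = n by lia.
  by rewrite !lognM ?muln_gt0 ?fact_gt0 ?bin_gt0 //; lia.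
have E : logn p n`! = \sum_(1 <= k < (2 * n).+1) n %/ p ^ k.
  rewrite logn_fact // [RHS](@big_cat_nat _ _ _ n.+1) //=; last by lia.
  rewrite -[LHS]addn0; congr (_ + _); rewrite big_nat_cond big1 //.
  move=> k /andP[/andP[nk _] _].
  by rewrite divn_small // (leq_trans nk) // ltnW // ltn_expl.
have Hs : \sum_(1 <= k < (2 * n).+1) 2 * n %/ p ^ k <=
   \sum_(1 <= k < (2 * n).+1) (2 * (n %/ p ^ k) + (k <= L)).
  apply: leq_sum => k _; case: (leqP k L) => [kL|Lk].
    have pk0 : 0 < p ^ k by rewrite expn_gt0 ltnW.
    by rewrite -ltnS ltn_divLR //; have := ltn_ceil n pk0; lia.
  rewrite divn_small ?leq0n // (leq_trans (trunc_log_ltn _ p1)) //.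
  by rewrite leq_pexp2l // ltnW.
have HL : \sum_(1 <= k < (2 * n).+1) (k <= L) <= L.
  have le_all N : \sum_(1 <= k < N.+1) (k <= L) <= minn N L.
    elim: N => [|N IHN]; first by rewrite big_geq.
    by rewrite big_nat_recr //=; lia.
  exact: leq_trans (le_all _) (geq_minr _ _).
move: Hs; rewrite -logn_fact // big_split /= -big_distrr /= -E; lia.
Qed.

Lemma prod_uniq_primes_dvd (s : seq nat) n : uniq s ->
  {in s, forall p, prime p /\ p %| n} -> \prod_(p <- s) p %| n.
Proof.
elim: s => [|p s IH] /=; first by rewrite big_nil dvd1n.
case/andP=> ps us H; rewrite big_cons.
have [pp pn] := H p (mem_head _ _).
rewrite Gauss_dvd ?pn ?IH // => [q qs|]; first by apply: H; rewrite inE qs orbT.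
rewrite big_seq; elim/big_ind: _ => [|x y|q qs]; first exact: coprimen1.
  by rewrite coprimeMr => -> ->.
have [pq _] := H q (mem_behead (s := p :: s) qs).
by rewrite prime_coprime // dvdn_prime2 //; apply: contraNneq ps => ->.
Qed.

(** Two equal middle coefficients occur in the expansion of (1+1)^(2m+1). *)
Lemma bin_mid_le m : 'C(2 * m + 1, m) <= 4 ^ m.
Proof.
have := expnDn 1 1 (2 * m + 1).
rewrite (eq_bigr (fun i : 'I__ => 'C(2 * m + 1, i))); last by move=> i _; rewrite !exp1n !muln1.
have m1 : m < (2 * m + 1).+1 by lia.
have m2 : m.+1 < (2 * m + 1).+1 by lia.
rewrite (bigD1 (Ordinal m1)) //= (bigD1 (Ordinal m2)) /=; last by rewrite -val_eqE /=; lia.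
have -> : 'C(2 * m + 1, m.+1) = 'C(2 * m + 1, m).
  by rewrite -bin_sub; [congr 'C(_, _); lia | lia].
have -> : (1 + 1) ^ (2 * m + 1) = 2 * 4 ^ m by rewrite (addn1 (2 * m)) expnS expnM.
lia.
Qed.

(** Strong induction: an even [n > 2] is not prime; for [n = 2 * m + 1] the primes in (m+1, n]
    divide ['C(n, m)], which is at most [4 ^ m]. *)
Lemma primorial_le n : \prod_(0 <= p < n.+1 | prime p) p <= 4 ^ n.
Proof.
elim/ltn_ind: n => n IH.
have [n2|n2] := leqP n 2.
  case: n n2 {IH} => [|[|[|]]] // _;
  by rewrite unlock.
case: (boolP (odd n)) => on; last first.
  have np : ~~ prime n by apply: contraL on => /even_prime[|-> //]; lia.
  rewrite big_mkcond big_nat_recr //= (negPf np) muln1 -big_mkcond.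
  case: n n2 {on np} IH => // n _ IH.
  by apply: leq_trans (IH n _) _ => //; rewrite leq_pexp2l.
pose m := n./2; have En : n = 2 * m + 1 by have := odd_double_half n; rewrite on -mul2n; lia.
rewrite (@big_cat_nat _ _ _ m.+2) //=; last by lia.
have -> : 4 ^ n = 4 ^ m.+1 * 4 ^ m by rewrite -expnD; congr (_ ^ _); lia.
apply: leq_mul; first by apply: IH; lia.
apply: leq_trans (bin_mid_le m); rewrite -En.
have C0 : 0 < 'C(n, m) by rewrite bin_gt0; lia.
apply: dvdn_leq => //.
rewrite -big_filter; apply: prod_uniq_primes_dvd; first by rewrite filter_uniq ?iota_uniq.
move=> p; rewrite mem_filter mem_index_iota => /and3P[pp mp pn]; split=> //.
have : p %| n`! by rewrite dvdn_fact // prime_gt0.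
rewrite -(@bin_fact n m); last by lia.
rewrite Euclid_dvdM // => /orP[//|].
have -> : n - m = m.+1 by lia.
rewrite Euclid_dvdM //.
suff H k : k < p -> ~~ (p %| k`!) by rewrite (negPf (H m _)) ?(negPf (H m.+1 _)) //; lia.
elim: k => [|k IHk] kp; first by rewrite dvdn1; case: eqP pp => // ->.
rewrite factS Euclid_dvdM // negb_or IHk 1?ltnW // andbT.
by apply/negP => /dvdn_leq; lia.
Qed.

(** The three factors bound the prime powers with p < s, with s <= p <= m, and with p > m. In the
    middle range p^2 > 2n forces exponent at most 1, so the primorial bound applies. *)
Lemma central_bin_le s m n : 0 < n -> 2 * n < s * s -> s <= m.+1 -> m <= 2 * n ->
  'C(2 * n, n) <= (2 * n) ^ s * 4 ^ m
    * (2 * n) ^ count prime (index_iota m.+1 (2 * n).+1).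
Proof.
move=> n0 ns sm mn; set C := 'C(_, _).
have C0 : 0 < C by rewrite bin_gt0; lia.
pose f p := p ^ logn p C.
have f1 p : ~~ prime p -> f p = 1 by move=> np; rewrite /f lognE (negPf np).
have -> : C = \prod_(0 <= p < (2 * n).+1) f p.
  rewrite -{1}(partnT C0) (@widen_partn (maxn C (2 * n))) ?leq_maxl //.
  rewrite (@big_cat_nat _ _ _ (2 * n).+1) //=; last by rewrite ltnS leq_maxr.
  rewrite -[RHS]muln1; congr (_ * _); rewrite big_nat_cond big1 //.
  move=> p /andP[/andP[np _] _].
  have [pp|/f1 //] := boolP (prime p).
  suff: logn p C = 0 by move->.
  have : logn p C <= logn p (2 * n)`!.
    by apply: dvdn_leq_log; rewrite ?fact_gt0 // -(@bin_fact (2 * n) n) ?dvdn_mulr //; lia.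
  rewrite logn_fact // big_nat_cond big1 ?leqn0 => [/eqP //|k /andP[/andP[k0 _] _]].
  rewrite divn_small // (leq_trans np) // -{1}[p]expn1 leq_pexp2l //; exact: prime_gt0.
rewrite (@big_cat_nat _ _ _ m.+1) //=.
apply: leq_mul; last first.
  rewrite (bigID prime) /= [X in _ * X]big1 ?muln1 => [|p /f1 //].
  rewrite -iter_muln_1 -big_const_seq.
  by apply: leq_prod => p pp; apply: logn_central_bin.
rewrite (@big_cat_nat _ _ _ s) //=.
apply: leq_mul.
  rewrite -{2}[s]subn0 -prod_nat_const_nat; apply: leq_prod => p _.
  have [pp|/f1 ->] := boolP (prime p); [exact: logn_central_bin | lia].
apply: leq_trans (primorial_le m).
rewrite [leqRHS](@big_cat_nat _ _ _ s) //=.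
set A := \prod_(0 <= i < s | _) _.
have A0 : 0 < A by apply: prodn_cond_gt0 => p /prime_gt0.
apply: leq_trans (leq_pmull _ A0).
rewrite [leqRHS]big_mkcond big_nat [leqRHS]big_nat; apply: leq_prod => p /andP[sp pm].
case: ifP => [pp|/negbT/f1 -> //].
rewrite -{2}[p]expn1 /f leq_pexp2l ?prime_gt0 // -ltnS -(ltn_exp2l _ _ (prime_gt1 pp)).
apply: leq_ltn_trans (logn_central_bin p n pp n0) _.
by apply: leq_trans ns _; rewrite expnS expn1 leq_mul.
Qed.

Lemma exp4E k : 4 ^ k = 2 ^ (2 * k).
Proof. by rewrite expnM. Qed.

Lemma exp4_sqr k : 4 ^ k = 2 ^ k * 2 ^ k.
Proof. by rewrite -expnMn. Qed.

(** Compares exponents of 2 in the two bounds on the central binomial, with s = 2^(e+1); the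
    contribution of [m] is at most n/2. *)
Lemma prime_count_ge e m n : 2 * n < 4 ^ e.+1 -> 2 ^ e.+1 <= m.+1 -> 4 * m <= n ->
  n <= 4 * (e.+1 * (2 ^ e.+1 + count prime (index_iota m.+1 (2 * n).+1))).
Proof.
move=> e_gt es mn; case: (posnP n) => [->//|n0].
set f := count _ _.
suff : n <= 2 * (e.+1 * (2 ^ e.+1 + f) + m) by lia.
rewrite -(leq_exp2l _ _ (isT : 1 < 2)).
apply: leq_trans (central_bin_ge n) _.
apply: leq_trans (central_bin_le (2 ^ e.+1) m n n0 _ es _) _.
- by rewrite -exp4_sqr.
- by lia.
rewrite -/f mulnAC -expnD -exp4E [leqRHS]expnD leq_mul //.
rewrite (expnM 4 e.+1) leq_exp2r; first exact: ltnW.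
by rewrite addn_gt0 expn_gt0.
Qed.

Lemma many_primes c r : exists N0, forall N, N0 <= N ->
  c * (trunc_log 2 N).+1 ^ r <= count prime (index_iota (N %/ 16).+1 (N %/ 2).+1).
Proof.
have [x1 Hx1] := poly_le_exp 512 1.
have [x2 Hx2] := poly_le_exp (64 * c) r.+1.
exists (2 ^ (2 * x1 + x2 + 20)) => N HN.
(* Chosen so that (m, 2n] lies in the counted interval and [4 * m <= n]. *)
pose n := N %/ 4; pose m := N %/ 16.
have N16 : 16 <= N.
  by rewrite -[16]/(2 ^ 4); apply: leq_trans HN; rewrite leq_exp2l //; lia.
have n20 : 0 < 2 * n by rewrite /n; lia.
have [e e_le e_gt] : exists2 e, 4 ^ e <= 2 * n & 2 * n < 4 ^ e.+1.
  by exists (trunc_log 4 (2 * n)); [apply: trunc_logP | apply: trunc_log_ltn].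
have N_lt : N < 2 ^ (2 * e + 3).
  have -> : 2 ^ (2 * e + 3) = 2 * 4 ^ e.+1.
    by rewrite exp4E -expnS; congr (_ ^ _); lia.
  by move: e_gt; rewrite expnS /n; lia.
have X_gt : 2 * x1 + x2 + 20 < 2 * e + 3.
  by rewrite -(ltn_exp2l _ _ (isT : 1 < 2)); apply: leq_ltn_trans N_lt.
have T_le : (trunc_log 2 N).+1 <= 2 * e + 3.
  rewrite -(ltn_exp2l _ _ (isT : 1 < 2)); apply: leq_ltn_trans N_lt.
  by apply: trunc_logP => //; lia.
have {Hx1} He : 512 * e <= 2 ^ e by rewrite -[e in _ * e]expn1; apply: Hx1; lia.
have {Hx2} HX : 64 * c * (2 * e + 3) ^ r.+1 <= 8 * 4 ^ e.
  have -> : 8 * 4 ^ e = 2 ^ (2 * e + 3) by rewrite expnD -exp4E mulnC.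
  by apply: Hx2; lia.
clear HN N_lt.
set f0 := count _ _.
pose f := count prime (index_iota m.+1 (2 * n).+1).
have ff0 : f <= f0.
  rewrite /f /f0 -!size_filter; apply: uniq_leq_size.
    by rewrite filter_uniq ?iota_uniq.
  move=> p; rewrite !mem_filter !mem_index_iota => /and3P[-> -> /=].
  by rewrite /n; lia.
have es : 2 ^ e.+1 <= m.+1.
  have : 2 ^ e * 16 <= 2 ^ e * 2 ^ e by rewrite leq_mul2l; lia.
  by rewrite -exp4_sqr expnS; move: e_le; rewrite /m /n; lia.
have mn : 4 * m <= n by rewrite /m /n; lia.
have := prime_count_ge e m n e_gt es mn; rewrite -/f => Hn.
rewrite leqNgt; apply/negP => f0_lt.
have fX : f0 < c * (2 * e + 3) ^ r.
  apply: leq_trans f0_lt _; rewrite leq_mul2l; apply/orP; right.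
  by case: (posnP r) => [->|r0]; rewrite ?expn0 // leq_exp2r.
have e9 : 9 <= e by lia.
(* [h1] and [h2] bound the two terms of [Hn] by 4^e/16 and 4^e/4, whereas [n] is at least 4^e/2. *)
have h1 : e.+1 * 2 ^ e.+1 * 64 <= 4 ^ e.
  by rewrite exp4_sqr expnS; nia.
have h2 : e.+1 * f * 16 <= 4 ^ e.
  have : (2 * e + 2) * f <= (2 * e + 3) * (c * (2 * e + 3) ^ r).
    by apply: leq_mul; lia.
  by move: HX; rewrite expnS; nia.
have : 0 < 4 ^ e by rewrite expn_gt0.
by move: Hn; rewrite mulnDr; lia.
Qed.

(** * Covering the positions by residue classes *)

Lemma residue_cover (M : seq nat) : exists nM, forall N, nM <= N ->
  exists r : nat -> nat, forall i, i < N -> exists p j,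
    [/\ prime p, p \notin M, p < N, j < N & j != i /\
        (i = r p %[mod p] /\ j = r p %[mod p])].
Proof.
pose k := \max_(p <- M) p.
have Mk p : p \in M -> p <= k by move=> pM; apply: leq_bigmax_seq.
(* Seven blocks yield the factor 17, since 17 * 2^7 = 2176 <= 2187 = 3^7. *)
have [Q [uQ pQ gQ HQ]] := prime_euler_product 7 k.
pose w := maxn k (\max_(p <- Q) p).
have Qw p : p \in Q -> p <= w.
  by move=> qQ; rewrite leq_max (leq_bigmax_seq _ qQ) ?orbT.
have [N0 HN0] := many_primes 1 w.+1.
exists (N0 + 16 * w + 16) => N HN.
pose F := [seq p <- index_iota (N %/ 16).+1 (N %/ 2).+1 | prime p].
have sizeF : (trunc_log 2 N).+1 ^ w.+1 <= size F.
  by rewrite size_filter -[leqLHS]mul1n; apply: HN0; lia.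
have FP p : p \in F -> [/\ prime p, w < p, 2 * p <= N & N < 16 * p].
  by rewrite mem_filter mem_index_iota => /and3P[-> Np pN]; split=> //; lia.
have uF : uniq F by rewrite filter_uniq ?iota_uniq.
(* Smooth numbers account for one [size F], multiples for sixteen. The multiplier 0 puts position 0
   into [U], so positions outside [U] can use 0 as partner. *)
pose U := [seq n <- index_iota 1 N | smooth w n] ++
          [seq s * p | s <- iota 0 16, p <- F].
have sizeU : size U <= 17 * size F.
  rewrite size_cat size_allpairs size_iota mulSn leq_add2r.
  apply: leq_trans sizeF; apply: leq_trans (smooth_count w N).
  rewrite size_filter -sum1_count big_mkcond [leqRHS]big_nat_recr /=; last by lia.
  by apply: leq_trans (leq_addr _ _); apply: leq_sum => n _; case: smooth.
have Q1 : all (leq 1) Q by apply/allP => p /(allP pQ)/prime_gt0.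
have [r1] := greedy_sieve Q U uQ Q1.
set V := [seq _ <- U | _] => HV.
have sizeV : size V <= size F.
  have P0 : 0 < \prod_(p <- Q) p by rewrite big_seq prodn_cond_gt0 // => p /(allP Q1).
  rewrite -(leq_pmul2r P0).
  have : size U * \prod_(p <- Q) p.-1 <= 17 * size F * \prod_(p <- Q) p.-1.
    by rewrite leq_mul2r sizeU orbT.
  have -> : 17 * size F * \prod_(p <- Q) p.-1 = size F * (17 * \prod_(p <- Q) p.-1).
    by rewrite mulnAC mulnC mulnA.
  have h : 17 * \prod_(p <- Q) p.-1 <= \prod_(p <- Q) p by lia.
  move=> h2; apply: leq_trans HV _; apply: leq_trans h2 _.
  by rewrite leq_mul2l h orbT.
(* Primes of [F] are matched with the survivors [V] by index; surplus primes get the default 0. *)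
pose r p := if p \in Q then r1 p else if p \in F then nth 0 V (index p F) else 0.
exists r.
have notM p : w < p -> p \notin M.
  by move=> wp; apply: contraL wp => /Mk pk; rewrite -leqNgt leq_max pk.
have twice p i : 0 < p -> 2 * p <= N -> i < N ->
    exists j, [/\ j < N, j != i & j = i %[mod p]].
  move=> p0 pN iN; have [pi|ip] := leqP p i.
    by exists (i - p); split; [lia | lia | rewrite -{2}(subnK pi) modnDr].
  by exists (i + p); split; [lia | lia | rewrite modnDr].
move=> i iN; case: (boolP (i \in U)) => iU.
  case: (boolP (i \in V)) => iV.
    have iF : index i V < size F by apply: leq_trans sizeV; rewrite index_mem.
    pose p := nth 0 F (index i V).
    have pF : p \in F by apply: mem_nth.
    have [pp wp p2 _] := FP p pF.
    have rp : r p = i.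
      rewrite /r pF ifN; last by apply: contraL wp => /Qw; rewrite -leqNgt.
      by rewrite index_uniq // nth_index.
    have [j [jN ji jp]] := twice p i (prime_gt0 pp) p2 iN.
    by exists p, j; rewrite rp; split=> //; [exact: notM | have := prime_gt0 pp; lia].
  move: iV; rewrite mem_filter iU andbT => /allPn[p pQ' /negPn/eqP ip].
  have pp := allP pQ p pQ'; have pw := Qw p pQ'; have p0 := prime_gt0 pp.
  have [|j [jN ji jp]] := twice p i p0 _ iN; first lia.
  exists p, j; rewrite /r pQ' jp; split=> //; last by lia.
  by apply/negP => /Mk; have := allP gQ p pQ'; lia.
move: iU; rewrite mem_cat mem_filter mem_index_iota iN andbT negb_or => /andP[iS iF].
have i0 : 0 < i.
  rewrite lt0n; apply: contraNneq iF => ->.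
  have : 0 < size F by apply: leq_trans sizeF; rewrite expn_gt0.
  case: (F) => // p F' _; apply/allpairsP; exists (0, p); split=> //=; exact: mem_head.
move: iS; rewrite i0 andbT => /allPn[q]; rewrite mem_primes -ltnNge => /and3P[qp _ qi] wq.
have qle := dvdn_leq i0 qi.
(* The prime [q > w] is not in [Q]; were it in [F], then N < 16q would give i = s q with s < 16,
   placing [i] in [U]. *)
exists q, 0.
have -> : r q = 0.
  rewrite /r ifN; last by apply: contraL wq => /Qw; rewrite -leqNgt.
  rewrite ifN //; apply: contra iF => qF; have [_ _ _ q16] := FP q qF.
  case/dvdnP: qi => s es; apply/allpairsP; exists (s, q); split=> //.
  by rewrite mem_iota leq0n add0n -(ltn_pmul2r (prime_gt0 qp)) -es (ltn_trans iN).
split=> //; [exact: notM | exact: leq_ltn_trans iN | exact: leq_ltn_trans iN |].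
by split; [lia | split=> //; rewrite mod0n; apply/eqP].
Qed.

(** * From residue classes to consecutive integers *)

Local Open Scope ring_scope.

Theorem theorem2p2 (M : seq nat) (hk : (0 < size M)%N) (huniq : uniq M)
    (hM : all prime M) :
  exists nM : nat, forall N : nat, (nM <= N)%N ->
    exists a : int, forall i : 'I_N,
      let x := a + (i : nat)%:Z in
      let P := \prod_(j < N | j != i) (a + (j : nat)%:Z) in
      ~~ coprimez x P /\
      exists p : nat, [/\ prime p, p \notin M & (p%:Z %| gcdz x P)%Z].
Proof.
have [nM HM] := residue_cover M; exists nM => N /HM[r Hr].
pose S := [seq p <- iota 0 N | prime p].
(* [r p * p.-1] represents -r p modulo p within the naturals, so p divides a + k whenever k is in
   the class of [r p]. *)
have [a Ha] := @chinese_primes S (fun p => r p * p.-1)%N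
  (filter_uniq _ (iota_uniq _ _)) (filter_all _ _).
exists a%:Z => i x P.
have [p [j [pp pM pN jN [ji [ip jp]]]]] := Hr i (ltn_ord i).
have dvd k : k = r p %[mod p] -> (p %| a + k)%N.
  move=> kp; rewrite /dvdn -modnDm kp Ha ?mem_filter ?mem_iota ?pp //.
  by rewrite modnDm addnC -mulnS prednK ?prime_gt0 // modnMl.
have pg : (p%:Z %| gcdz x P)%Z.
  rewrite dvdz_gcd /x -PoszD; apply/andP; split; first by rewrite dvdzE /= dvd.
  rewrite /P (bigD1 (Ordinal jN)) //=; apply: dvdz_mulr.
  by rewrite -PoszD dvdzE /= dvd.
split; last by exists p.
apply: contraTN pg => /eqP ->; rewrite dvdz1 /=.
by case: p pp {pM pN ip jp dvd} => [|[]].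
Qed.
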